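(* Let $n\ge 1$ be a natural number and let $\sum_{m=1}^{\infty} a_m$ be a conditionally convergent series of real numbers $a_m$. For each $\sigma\in \mathrm{Sym}(n)$, let $s^{(\sigma)}$ be a real number or $\pm\infty$. Then there exists a rearrangement $\big( b(j_1,\dots,j_n)\;\big|\; j_1,\dots,j_n\ge 1\big)$ of $(a_m)_m$ such that for each $\sigma\in \mathrm{Sym}(n)$ one has $$\sum_{j_1=1}^{\infty}\sum_{j_2=1}^{\infty}\dots\sum_{j_n=1}^{\infty} b(j_{\sigma(1)},\dots,j_{\sigma(n)})=s^{(\sigma)}.$$
   Context: $\mathbb{N}=\{1,2,3,\dots\}$, and $\mathrm{Sym}(n)$ is the group of all permutations of $\{1,\dots,n\}$. A series of real numbers is conditionally convergent if it converges but does not converge absolutely. Rearrangement: a rearrangement $\big( b(j_1,\dots,j_n)\;\big|\; j_1,\dots,j_n\ge 1\big)$ of a sequence $(a_m)_{m\in\mathbb{N}}$ is a mapping $b:\mathbb{N}^n\to\mathbb{R}$ for which there is a bijection $\tau:\mathbb{N}^n\to\mathbb{N}$ with $b(j_1,\dots,j_n)=a_{\tau(j_1,\dots,j_n)}$ for all $(j_1,\dots,j_n)\in\mathbb{N}^n$. Multiple sums are iterated sums, evaluated from the innermost (over $j_n$) to the outermost (over $j_1$); each infinite sum is the limit of its partial sums in the natural order of the index. The equality includes the assertion that the inner sums (over $j_2,\dots,j_n$) converge to real numbers; the outermost sum (over $j_1$) converges to $s^{(\sigma)}$ if $s^{(\sigma)}$ is real and has partial sums tending to $\pm\infty$ if $s^{(\sigma)}=\pm\infty$.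 *)

(* Defs.v *)
From mathcomp Require Import all_boot all_order all_algebra all_fingroup.
From mathcomp Require Import all_classical all_reals all_analysis.
Set Implicit Arguments.
Unset Strict Implicit.
Unset Printing Implicit Defensive.
Import Order.TTheory GRing.Theory Num.Theory.
Import numFieldNormedType.Exports.
Local Open Scope classical_set_scope.
Local Open Scope ring_scope.

(* All indices start at 0 rather than 1: the m-th term (m >= 1) of a sequence
   is [a m.-1], and a multi-index of N^n is an [n.-tuple nat] whose k-th
   component (k >= 1) is the [tnth] at the ordinal of value k.-1. *)

Definition conditionally_convergent (R : realType) (a : R^nat) : Prop :=
  cvgn (series a) /\ ~ cvgn [normed series a].

Definition rearrangement (R : realType) (n : nat) (a : R^nat)
    (b : n.-tuple nat -> R) : Prop :=
  exists2 tau : n.-tuple nat -> nat,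
    bijective tau & forall j, b j = a (tau j).

(* [iterated_sum f s]: the sum of [f], iterated from the innermost index (the
   last component) to the outermost one (the first), is [s]. The values [g j]
   of the inner sums are required to exist in R; only the outermost sum may
   diverge to +oo or -oo. *)
Fixpoint iterated_sum (R : realType) (n : nat) :
    (n.-tuple nat -> R) -> \bar R -> Prop :=
  match n with
  | 0 => fun f s => s = (f [tuple])%:E
  | n'.+1 => fun f s => exists2 g : R^nat,
      forall j, @iterated_sum R n' (fun t => f [tuple of j :: t]) (g j)%:E &
      (series g k)%:E @[k --> \oo] --> s
  end.

(* (j_1, ..., j_n) |-> (j_(sigma 1), ..., j_(sigma n)) *)
Definition permute_index (n : nat) (sigma : 'S_n) (j : n.-tuple nat) :
    n.-tuple nat :=
  [tuple tnth j (sigma i) | i < n].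

(* Main.v *)
Require Import Defs.
From mathcomp Require Import all_boot all_order all_algebra all_fingroup.
From mathcomp Require Import all_classical all_reals all_analysis.
From mathcomp Require Import zify lra.
Set Implicit Arguments.
Unset Strict Implicit.
Unset Printing Implicit Defensive.
Import Order.TTheory GRing.Theory Num.Theory.
Import numFieldNormedType.Exports.
Local Open Scope classical_set_scope.
Local Open Scope ring_scope.

(* Call "line" any one-parameter subset of N^n obtained by fixing all coordinates
   but one.  The terms a_m can be placed on N^n so that the sums along all lines
   have arbitrarily prescribed values: enumerate the lines, let each point belong
   to the first line through it, and split the indices m into one class per line,
   each class having infinite positive and infinite negative mass.  Two lines
   meet in at most one point, so a line owns all but finitely many of its points;
   going through the lines in order, Riemann's greedy algorithm arranges the class
   of a line on the points it owns and compensates for the finitely many values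
   already placed there.

   Now induct on n.  The innermost sum of the iterated sum for sigma runs along
   the lines in one direction d, so it suffices to prescribe as line sums in
   direction d an array on N^(n-1) whose iterated sums are the values s(sigma)
   for the (n-1)! permutations with innermost direction d; the induction
   hypothesis provides one. *)

(** * Counters that advance by zero or one *)

Lemma counter_homo (f : nat -> nat) (b : pred nat) :
  (forall k, f k.+1 = f k + b k)%N -> {homo f : j k / (j <= k)%N}.
Proof.
move=> fS; apply: homo_leq => [//|? ? ?|k]; first exact: leq_trans.
by rewrite fS leq_addr.
Qed.

Lemma counter_inj (f : nat -> nat) (b : pred nat) :
  (forall k, f k.+1 = f k + b k)%N -> {in b &, injective f}.
Proof.
move=> fS j k; rewrite -!topredE/= => bj bk fjk.
case: (ltngtP j k) => // jk; have /= := counter_homo fS jk; rewrite fS fjk.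
  by rewrite bj addn1 ltnn.
by rewrite bk addn1 ltnn.
Qed.

(** The last step before [f] exceeds [i] raises it from [i]. This is why the greedy algorithm uses
    every term. *)
Lemma counter_hits (f : nat -> nat) (b : pred nat) : f 0%N = 0%N ->
  (forall k, f k.+1 = f k + b k)%N -> (forall K, exists2 k, (K <= k)%N & b k) ->
  forall i, exists2 k, b k & f k = i.
Proof.
move=> f0 fS binf.
have hit i : exists k, (i <= f k)%N.
  elim: i => [|i [k ik]]; first by exists 0%N.
  have [l kl bl] := binf k; exists l.+1; rewrite fS bl addn1 ltnS.
  exact: leq_trans ik (counter_homo fS kl).
move=> i; have := hit i.+1; case/ex_minnP=> -[|k]; first by rewrite f0.
rewrite fS => ik kmin; have fki : (f k <= i)%N.
  by rewrite leqNgt; apply/negP => /kmin; rewrite ltnn.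
by exists k; move: ik; case: (b k) => //=; lia.
Qed.

(** * Riemann's greedy algorithm *)

Record null_divergent (R : realType) (x : R^nat) : Prop := NullDivergent {
  nd_ge0 : forall i, 0 <= x i;
  nd_cvg : x @ \oo --> (0 : R);
  nd_dvg : series x @ \oo --> +oo }.

(* The state of Riemann's greedy algorithm after [k] steps: [p] terms of [x]
   have been added, [q] terms of [y] have been subtracted, and [S] is the
   partial sum.  The positions in [U] are prefilled with the values [v].  The
   threshold moves with [q], which allows it to tend to infinity. *)
Record greedy_run (R : realType) (x y : R^nat) (U : pred nat) (v thr : R^nat)
    (p q : nat -> nat) (S : R^nat) : Prop := GreedyRun {
  run_p0 : p 0%N = 0%N;
  run_q0 : q 0%N = 0%N;
  run_S0 : S 0%N = 0;
  run_pS : forall k, p k.+1 = (p k + (~~ U k && (S k <= thr (q k))%R))%N;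
  run_qS : forall k, q k.+1 = (q k + (~~ U k && (thr (q k) < S k)%R))%N;
  run_SS : forall k, S k.+1 = S k +
    if U k then v k else if S k <= thr (q k) then x (p k) else - y (q k) }.

Lemma greedy_exists (R : realType) (x y : R^nat) (U : pred nat) (v thr : R^nat) :
  exists p q S, greedy_run x y U v thr p q S.
Proof.
pose step k (s : nat * nat * R) := let: (p, q, t) := s in
  ((p + (~~ U k && (t <= thr q)%R))%N, (q + (~~ U k && (thr q < t)%R))%N,
   t + if U k then v k else if t <= thr q then x p else - y q).
pose st k := iteri k step (0%N, 0%N, 0).
exists (fun k => (st k).1.1), (fun k => (st k).1.2), (fun k => (st k).2).
by split=> // k; rewrite /st /=; case: (iteri _ _ _) => -[].
Qed.

Lemma cvgnP_ge (R : realType) (u : R^nat) : u @ \oo --> +oo ->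
  forall C, exists N, forall n, (N <= n)%N -> C <= u n.
Proof. by move=> /cvgryPge + C => /(_ C)[N _ NC]; exists N => n /NC. Qed.

Lemma cvg0_le (R : realType) (u : R^nat) : u @ \oo --> (0 : R) ->
  forall e, 0 < e -> exists N, forall n, (N <= n)%N -> `|u n| <= e.
Proof.
move=> /cvgrPdist_le + e e0 => /(_ e e0)[N _ Ne]; exists N => n /Ne/=.
by rewrite sub0r normrN.
Qed.

(** Otherwise only terms of [y] are subtracted from some step on, and their divergent sum pushes [S]
    below [thr 0], a lower bound for all thresholds. *)
Lemma greedy_up (R : realType) (x y : R^nat) U v thr p q S (B : nat) :
  greedy_run x y U v thr p q S -> null_divergent y ->
  {homo thr : i j / (i <= j)%N >-> i <= j} ->
  (forall k, (B <= k)%N -> ~~ U k) ->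
  forall K, exists2 k, (K <= k)%N & ~~ U k && (S k <= thr (q k)).
Proof.
move=> run [y0 _ ydvg] thr_homo UB K; apply: contrapT => noup.
pose K0 := maxn K B.
have down j : ~~ U (K0 + j)%N /\ thr (q (K0 + j)%N) < S (K0 + j)%N.
  have Uj : ~~ U (K0 + j)%N by apply: UB; rewrite /K0; lia.
  split=> //; rewrite ltNge; apply/negP => Sle; apply: noup.
  by exists (K0 + j)%N; [rewrite /K0; lia|rewrite Uj].
have qj j : q (K0 + j)%N = (q K0 + j)%N.
  elim: j => [|j IH]; first by rewrite !addn0.
  have [Uj tj] := down j.
  by rewrite !addnS (run_qS run) Uj tj IH addn1.
have Sj j : S (K0 + j)%N = S K0 + series y (q K0) - series y (q K0 + j)%N.
  elim: j => [|j IH]; first by rewrite !addn0 addrK.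
  have [Uj tj] := down j.
  rewrite !addnS (run_SS run) (negbTE Uj) leNgt tj /= IH seriesS qj.
  by lra.
have [N yN] := cvgnP_ge ydvg (S K0 + series y (q K0) - thr 0%N).
have [_ tN] := down N; have := yN (q K0 + N)%N (leq_addl _ _).
have := thr_homo 0%N (q (K0 + N)%N) (leq0n _).
move: tN; rewrite Sj; lra.
Qed.

(** Otherwise only terms of [x] are added from some step on; [q], and with it the threshold, stays
    fixed while [S] grows without bound. *)
Lemma greedy_down (R : realType) (x y : R^nat) U v thr p q S (B : nat) :
  greedy_run x y U v thr p q S -> null_divergent x ->
  (forall k, (B <= k)%N -> ~~ U k) ->
  forall K, exists2 k, (K <= k)%N & ~~ U k && (thr (q k) < S k).
Proof.
move=> run [x0 _ xdvg] UB K; apply: contrapT => nodown.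
pose K0 := maxn K B.
have up j : ~~ U (K0 + j)%N /\ S (K0 + j)%N <= thr (q (K0 + j)%N).
  have Uj : ~~ U (K0 + j)%N by apply: UB; rewrite /K0; lia.
  split=> //; rewrite leNgt; apply/negP => Sle; apply: nodown.
  by exists (K0 + j)%N; [rewrite /K0; lia|rewrite Uj].
have pqj j : p (K0 + j)%N = (p K0 + j)%N /\ q (K0 + j)%N = q K0.
  elim: j => [|j [IHp IHq]]; first by rewrite !addn0.
  have [Uj tj] := up j.
  by rewrite !addnS (run_pS run) (run_qS run) Uj tj ltNge tj IHp IHq addn1 addn0.
have Sj j : S (K0 + j)%N = S K0 - series x (p K0) + series x (p K0 + j)%N.
  elim: j => [|j IH]; first by rewrite !addn0 subrK.
  have [Uj tj] := up j.
  rewrite !addnS (run_SS run) (negbTE Uj) tj /= IH seriesS (pqj j).1.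
  by lra.
have [N xN] := cvgnP_ge xdvg (thr (q K0) - S K0 + series x (p K0) + 1).
have [_] := up N; have := xN (p K0 + N)%N (leq_addl _ _).
rewrite Sj (pqj N).2; lra.
Qed.

(* Once [S] has been above [thr P], it falls below it by at most one small
   term at a time. *)
Lemma greedy_lower (R : realType) (x y : R^nat) U v thr p q S (B : nat) :
  greedy_run x y U v thr p q S -> null_divergent x -> null_divergent y ->
  {homo thr : i j / (i <= j)%N >-> i <= j} ->
  (forall k, (B <= k)%N -> ~~ U k) ->
  forall P e, 0 < e -> exists K, forall k, (K <= k)%N -> thr P - e <= S k.
Proof.
move=> run xnd ynd thr_homo UB P e e0.
have downs := greedy_down run xnd UB.
have [N yN] := cvg0_le (nd_cvg ynd) e0.
(* Once [q] has reached [maxn N P], each subtracted term is at most [e] and the threshold is at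
   least [thr P]. *)
have [k _ qk] := counter_hits (run_q0 run) (run_qS run) downs (maxn N P).
have [K kK /andP[UK tK]] := downs (maxn k B).
have q_homo := counter_homo (run_qS run).
exists K => l /subnKC <-; elim: (l - K)%N => [|j IH].
  rewrite addn0; have : thr P <= thr (q K).
    by apply: thr_homo; have := q_homo k K; lia.
  by lra.
have [qN qP] : (N <= q (K + j))%N /\ (P <= q (K + j))%N.
  by have := q_homo k (K + j)%N; split; lia.
have Uj : ~~ U (K + j)%N by apply: UB; lia.
rewrite addnS (run_SS run) (negbTE Uj); case: ifPn => [_|].
  by have := nd_ge0 xnd (p (K + j)%N); lra.
rewrite -ltNge => tj; have := thr_homo _ _ qP.
have := yN _ qN; have := ler_norm (y (q (K + j)%N)); lra.
Qed.

(** Past the prefilled positions [S] rises only from values at most [M], by terms that are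
    eventually at most [e]. *)
Lemma greedy_upper (R : realType) (x y : R^nat) U v thr p q S (B : nat) :
  greedy_run x y U v thr p q S -> null_divergent x -> null_divergent y ->
  {homo thr : i j / (i <= j)%N >-> i <= j} ->
  (forall k, (B <= k)%N -> ~~ U k) ->
  forall M e, (forall i, thr i <= M) -> 0 < e ->
  exists K, forall k, (K <= k)%N -> S k <= M + e.
Proof.
move=> run xnd ynd thr_homo UB M e thrM e0.
have ups := greedy_up run ynd thr_homo UB.
have [N xN] := cvg0_le (nd_cvg xnd) e0.
have [k _ pk] := counter_hits (run_p0 run) (run_pS run) ups N.
have [K kK /andP[UK tK]] := ups (maxn k B).
have p_homo := counter_homo (run_pS run).
exists K => l /subnKC <-; elim: (l - K)%N => [|j IH].
  by rewrite addn0; have := thrM (q K); lra.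
have pN : (N <= p (K + j))%N by have := p_homo k (K + j)%N; lia.
have Uj : ~~ U (K + j)%N by apply: UB; lia.
rewrite addnS (run_SS run) (negbTE Uj); case: ifPn => [tj|_].
  have := thrM (q (K + j)%N); have := xN _ pN.
  have := ler_norm (x (p (K + j)%N)); lra.
by have := nd_ge0 ynd (q (K + j)%N); lra.
Qed.

(** * Enumerating the terms of one sign in a class *)

Lemma increasing_enum (P : pred nat) :
  (forall N, exists2 m, (N <= m)%N & P m) ->
  exists e : nat -> nat, [/\ {mono e : i j / (i < j)%N},
    forall i, P (e i) & forall m, P m -> exists i, e i = m].
Proof.
move=> Pinf; have Pinf' N : exists m, (N <= m)%N && P m.
  by have [m Nm Pm] := Pinf N; exists m; rewrite Nm.
pose next N := ex_minn (Pinf' N).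
have nextP N : [/\ (N <= next N)%N, P (next N) &
    forall m, (N <= m)%N -> P m -> (next N <= m)%N].
  rewrite /next; case: ex_minnP => m /andP[Nm Pm] mmin; split=> // l Nl Pl.
  by apply: mmin; rewrite Nl.
pose e i := iter i (next \o succn) (next 0%N).
have eS i : (e i < e i.+1)%N by rewrite /e iterS; case: (nextP (e i).+1).
have e_homo : {homo e : i j / (i < j)%N} by apply: homo_ltn => // ???; apply: ltn_trans.
exists e; split.
- move=> i j; case: (ltngtP i j) => [/e_homo -> //|/e_homo|->]; last by rewrite ltnn.
  by move=> ji; apply/negbTE; rewrite -leqNgt ltnW.
- by case=> [|i]; [case: (nextP 0%N)|rewrite /e iterS; case: (nextP (e i).+1)].
- move=> m Pm; have ei i : (i <= e i)%N.
    by elim: i => // i IH; apply: leq_ltn_trans IH (eS i).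
  have : exists i, (m <= e i)%N by exists m.
  case/ex_minnP => i mi imin; exists i; apply/eqP; rewrite eqn_leq mi andbT.
  case: i mi imin => [_ _|i mi imin]; first by case: (nextP 0%N) => _ _; apply.
  rewrite /e iterS; case: (nextP (e i).+1) => _ _; apply=> //.
  by rewrite ltnNge; apply/negP => /imin; rewrite ltnn.
Qed.

Definition heavy (R : realType) (a : R^nat) (F : pred nat) : Prop :=
  forall C, exists N, C <= \sum_(0 <= m < N | F m) Num.max (a m) 0.

(** [P] may contain or omit zero terms of [F]. So the lemma serves the nonnegative terms and, with
    [- a] for [a], the strictly negative ones. *)
Lemma heavy_enum (R : realType) (a : R^nat) (F P : pred nat) :
  a @ \oo --> (0 : R) -> heavy a F ->
  (forall m, P m -> F m /\ 0 <= a m) -> (forall m, F m -> ~~ P m -> a m <= 0) ->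
  exists e : nat -> nat, [/\ injective e, forall m, P m <-> exists i, e i = m &
    null_divergent (a \o e)].
Proof.
move=> a0 Fh PF FP.
have {}Fh C : exists N, C <= \sum_(0 <= m < N | P m) a m.
  have [N CN] := Fh C; exists N; apply: le_trans CN _.
  rewrite big_mkcond [leRHS]big_mkcond /= le_eqVlt; apply/orP; left; apply/eqP.
  apply: eq_bigr => m _; have := PF m; case: ifP => Fm; case: ifP => Pm //.
  - by move=> /(_ isT)[_]; exact: max_l.
  - by move=> _; apply: max_r; apply: FP; rewrite ?Fm ?Pm.
  - by move=> /(_ isT)[].
have Pinf N : exists2 m, (N <= m)%N & P m.
  apply: contrapT => noP.
  have [M] := Fh (\sum_(0 <= m < N | P m) a m + 1); apply/negP; rewrite -ltNge.
  apply: (@le_lt_trans _ _ (\sum_(0 <= m < N | P m) a m)); last by rewrite ltrDl.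
  have [NM|/ltnW MN] := leqP N M.
    rewrite (big_cat_nat (n := N))//= [X in _ + X]big1_seq ?addr0// => m /andP[Pm].
    by rewrite mem_index_iota => /andP[Nm _]; exfalso; apply: noP; exists m.
  rewrite [leRHS](big_cat_nat (n := M))//= lerDl sumr_ge0// => m /PF[].
  by [].
have [e [e_mono eP Pe]] := increasing_enum Pinf.
have e_inj : injective e.
  move=> i j eij; have := e_mono i j; have := e_mono j i.
  by rewrite eij !ltnn; case: ltngtP.
exists e; split=> //; first by move=> m; split=> [/Pe//|[i <-]].
split.
- by move=> i; have [] := PF _ (eP i).
- apply: cvg_comp a0 => /=; apply/cvgnyPge => N; exists N => // i /= Ni.
  apply: (leq_trans Ni) => {Ni}; elim: i => // i IH; apply: leq_ltn_trans IH _.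
  by rewrite e_mono.
apply/cvgryPge => C; have [N CN] := Fh C.
(* [k] counts the enumerated indices below [N]. *)
have [k [_ kN]] : exists k, (forall i, (e i < N)%N = (i < k)%N) /\
    \sum_(0 <= m < N | P m) a m = series (a \o e) k.
  elim: N {CN} => [|N [k [ek kN]]]; first by exists 0%N; rewrite /series /= !big_geq.
  rewrite big_mkcond big_nat_recr //= -big_mkcond kN.
  case: ifP => PN; last first.
    exists k; split; last by rewrite addr0.
    move=> i; rewrite ltnS leq_eqVlt ek.
    by case: eqP => // eiN; rewrite -eiN eP in PN.
  have [j ej] := Pe _ PN.
  have jk : j = k.
    case: (ltngtP j k) => // [|kj]; first by rewrite -ek ej ltnn.
    by have := ek k; rewrite ltnn -ej e_mono kj.
  exists k.+1; split; last by rewrite seriesSr /= -jk ej.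
  move=> i; rewrite !ltnS leq_eqVlt ek [RHS]leq_eqVlt -ej -jk; congr (_ || _).
  by apply/eqP/eqP => [/e_inj|->].
exists k => // l /= kl; apply: le_trans CN _; rewrite kN /series /=.
rewrite [leRHS](big_cat_nat (n := k))//= lerDl sumr_ge0// => i _.
by have [] := PF _ (eP i).
Qed.

(** * Riemann's theorem with prefilled positions *)

(** A bijection from the complement of [U] onto [F]; on [U] the values of [pi] are free. *)
Definition fills (F U : pred nat) (pi : nat -> nat) : Prop :=
  [/\ {in predC U &, injective pi}, forall k, ~~ U k -> F (pi k) &
      forall m, F m -> exists2 k, ~~ U k & pi k = m].

(* Riemann's rearrangement theorem, with the positions in the finite set [U]
   prefilled by [v].  For a finite limit the threshold is constant, for +oo it is
   the number of terms subtracted so far. *)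
Lemma riemann_notNy (R : realType) (a v : R^nat) (F U : pred nat) (B : nat)
    (t : \bar R) :
  a @ \oo --> (0 : R) -> heavy a F -> heavy (- a) F ->
  (forall k, (B <= k)%N -> ~~ U k) -> t != -oo%E ->
  exists2 pi, fills F U pi &
    (series (fun k => if U k then v k else a (pi k)) n)%:E @[n --> \oo] --> t.
Proof.
move=> a0 Fp Fn UB tNy.
pose P m := F m && (0 <= a m); pose Q m := F m && (a m < 0).
have [ep [ep_inj epP xnd]] : exists e : nat -> nat, [/\ injective e,
    forall m, P m <-> exists i, e i = m & null_divergent (a \o e)].
  apply: heavy_enum a0 Fp _ _ => m; first by move=> /andP.
  by move=> Fm; rewrite /P Fm -ltNge => /ltW.
have [eq [eq_inj eqP' ynd]] : exists e : nat -> nat, [/\ injective e,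
    forall m, Q m <-> exists i, e i = m & null_divergent ((- a) \o e)].
  apply: heavy_enum Fn _ _ => [|m|m].
  - by rewrite -oppr0; exact: cvgN.
  - by move=> /andP[Fm am]; rewrite Fm /= oppr_ge0 ltW.
  - by move=> Fm; rewrite /Q Fm -leNgt /= oppr_le0.
have [thr thr_homo thrt] : exists2 thr : R^nat,
    {homo thr : i j / (i <= j)%N >-> i <= j} &
    if t is r%:E then thr = fun=> r else thr = fun n => n%:R.
  case: t tNy => [r| |//] _; first by exists (fun=> r).
  by exists (fun n => n%:R) => // i j ij; rewrite ler_nat.
have [p [q [S run]]] := greedy_exists (a \o ep) ((- a) \o eq) U v thr.
pose up k := S k <= thr (q k).
pose pi k := if up k then ep (p k) else eq (q k).
exists pi.
  split=> [j k|k Uk|m Fm].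
  - rewrite !inE /pi => Uj Uk; case: ifP => uj; case: ifP => uk.
    + move=> /ep_inj; apply: (counter_inj (run_pS run)); rewrite unfold_in.
      * by rewrite /= Uj.
      * by rewrite /= Uk.
    + move=> epq; have /epP/andP[_] : exists i, ep i = ep (p j) by exists (p j).
      have /eqP'/andP[_] : exists i, eq i = eq (q k) by exists (q k).
      by rewrite epq => /lt_geF ->.
    + move=> epq; have /epP/andP[_] : exists i, ep i = ep (p k) by exists (p k).
      have /eqP'/andP[_] : exists i, eq i = eq (q j) by exists (q j).
      by rewrite epq => /lt_geF ->.
    + move=> /eq_inj; apply: (counter_inj (run_qS run)); rewrite unfold_in.
      * by rewrite /= Uj ltNge -/(up j) uj.
      * by rewrite /= Uk ltNge -/(up k) uk.
  - rewrite /pi; case: ifP => _.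
      by have /epP/andP[] : exists i, ep i = ep (p k) by exists (p k).
    by have /eqP'/andP[] : exists i, eq i = eq (q k) by exists (q k).
  - have [am|am] := leP 0 (a m).
      have [|i] := (epP m).1; first by rewrite /P Fm.
      have [k /andP[Uk upk] <-] := counter_hits (run_p0 run) (run_pS run)
        (greedy_up run ynd thr_homo UB) i.
      by exists k; rewrite // /pi /up upk.
    have [|i] := (eqP' m).1; first by rewrite /Q Fm.
    have [k /andP[Uk upk] <-] := counter_hits (run_q0 run) (run_qS run)
      (greedy_down run xnd UB) i.
    by exists k; rewrite // /pi /up leNgt upk.
have -> : series (fun k => if U k then v k else a (pi k)) = S.
  apply/funext; elim=> [|k IH]; first by rewrite (run_S0 run) /series /= big_geq.
  rewrite seriesSr IH (run_SS run) /pi -/(up k) /=.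
  by case: (U k) => //; case: (up k) => //=; rewrite opprK.
have lower := greedy_lower run xnd ynd thr_homo UB.
case: t tNy thrt => [r| |//] _ thrE; last first.
  apply/cvgeryP/cvgryPge => C; have [K SK] := lower (Num.truncn (C + 1)).+1 1 ltr01.
  exists K => // k /SK; apply: le_trans; rewrite thrE.
  by rewrite lerBrDr ltW// truncnS_gt.
apply: cvg_EFin; first exact: nearW.
apply/cvgrPdist_le => e e0.
have [K SK] := lower 0%N e e0.
have [|K' SK'] := greedy_upper (M := r) run xnd ynd thr_homo UB _ e0.
  by move=> i; rewrite thrE.
exists (maxn K K') => // k /=; rewrite geq_max => /andP[/SK + /SK'].
by rewrite thrE ler_distlC => -> ->.
Qed.

(** Negating [a] and [v] turns the limit [-oo] into [+oo]. *)
Lemma riemann_fill (R : realType) (a v : R^nat) (F U : pred nat) (B : nat)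
    (t : \bar R) :
  a @ \oo --> (0 : R) -> heavy a F -> heavy (- a) F ->
  (forall k, (B <= k)%N -> ~~ U k) ->
  exists2 pi, fills F U pi &
    (series (fun k => if U k then v k else a (pi k)) n)%:E @[n --> \oo] --> t.
Proof.
move=> a0 Fp Fn UB; have [tNy|] := eqVneq t -oo%E; last exact: riemann_notNy UB.
have [||||pi piF cvg] := @riemann_notNy R (- a) (- v) F U B +oo%E _ _ _ UB.
- by rewrite -oppr0; exact: cvgN.
- by [].
- by rewrite opprK.
- by [].
exists pi => //; rewrite tNy; apply/cvgeNP.
apply: cvg_trans cvg; apply: near_eq_cvg; apply: nearW => n /=.
rewrite /series /= -sumrN; congr (_%:E); apply: eq_bigr => k _.
by case: ifP.
Qed.

(** * Splitting the indices into classes of infinite mass *)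

Lemma heavy_tail (R : realType) (a : R^nat) : heavy a predT ->
  forall N C, exists2 M, (N <= M)%N & C <= \sum_(N <= m < M) Num.max (a m) 0.
Proof.
move=> ah N C.
have [M CM] := ah (C + \sum_(0 <= m < N) Num.max (a m) 0).
have [NM|/ltnW MN] := leqP N M.
  exists M => //; rewrite [leRHS](big_cat_nat (n := N))//= in CM.
  by move: CM; lra.
exists N => //; rewrite big_geq//; move: CM.
rewrite [X in C + X](big_cat_nat (n := M))//= addrCA gerDl; apply: le_trans.
by rewrite lerDl; apply: sumr_ge0 => m _; rewrite le_max lexx orbT.
Qed.

(* The n-th of consecutive blocks has mass at least n for both sequences; a
   class is a union of infinitely many blocks. *)
Lemma heavy_partition (R : realType) (I : countType) (i0 : I) (a b : R^nat) :
  heavy a predT -> heavy b predT ->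
  exists c : nat -> I,
    forall i, heavy a (fun m => c m == i) /\ heavy b (fun m => c m == i).
Proof.
move=> ah bh.
have /choice[next nextP] (kN : nat * nat) : exists M, [/\ (kN.2 < M)%N,
    kN.1%:R <= \sum_(kN.2 <= m < M) Num.max (a m) 0 &
    kN.1%:R <= \sum_(kN.2 <= m < M) Num.max (b m) 0].
  case: kN => k N /=.
  have [M1 NM1 aM1] := heavy_tail ah N k%:R.
  have [M2 NM2 bM2] := heavy_tail bh N k%:R.
  have extend (d : R^nat) M M' : (N <= M)%N -> (M <= M')%N ->
      \sum_(N <= m < M) Num.max (d m) 0 <= \sum_(N <= m < M') Num.max (d m) 0.
    move=> NM MM'; rewrite [leRHS](big_cat_nat (n := M))//= lerDl.
    by apply: sumr_ge0 => m _; rewrite le_max lexx orbT.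
  exists (maxn M1 M2).+1; split; first by rewrite ltnS; lia.
    by apply: le_trans aM1 _; apply: extend => //; lia.
  by apply: le_trans bM2 _; apply: extend => //; lia.
pose cut := fix cut k := if k is k'.+1 then next (k', cut k') else 0%N.
have cutS k : (cut k < cut k.+1)%N by have [] := nextP (k, cut k).
have cut_homo : {homo cut : j k / (j <= k)%N}.
  by apply: homo_leq => // [? ? ?|k]; [exact: leq_trans|exact: ltnW].
have /choice[block blockP] m : exists k, (cut k <= m < cut k.+1)%N.
  have kcut k : (k <= cut k)%N by elim: k => // k IH; apply: leq_ltn_trans IH (cutS k).
  have : exists k, (m < cut k.+1)%N by exists m.
  case/ex_minnP => k mk kmin; exists k; rewrite mk andbT.
  case: k mk kmin => [//|k] _ kmin; rewrite leqNgt; apply/negP => /kmin.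
  by rewrite ltnn.
have blockE k m : (cut k <= m < cut k.+1)%N -> block m = k.
  move=> /andP[km mk]; have /andP[bm mb] := blockP m; apply/eqP.
  rewrite eqn_leq; apply/andP; split; rewrite leqNgt; apply/negP => /cut_homo.
    by rewrite leqNgt (leq_ltn_trans bm mk).
  by rewrite leqNgt (leq_ltn_trans km mb).
(* The class of block [k] is coded by the exponent of 2 in [k.+1], so each code recurs infinitely
   often; [i0] stands in for exponents that code nothing. *)
pose c m := odflt i0 (unpickle (logn 2 (block m).+1)); exists c => i.
have heavy_class (d : R^nat) :
    (forall k, k%:R <= \sum_(cut k <= m < cut k.+1) Num.max (d m) 0) ->
    heavy d (fun m => c m == i).
  (* The odd cofactor keeps the exponent at [pickle i] and makes [k], hence the mass of the block,
     at least [C]. *)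
  move=> dk C; pose k := (2 ^ pickle i * (Num.truncn C).+1.*2.+1).-1.
  have kS : k.+1 = (2 ^ pickle i * (Num.truncn C).+1.*2.+1)%N.
    by rewrite /k prednK// muln_gt0 expn_gt0.
  have ck m : (cut k <= m < cut k.+1)%N -> c m = i.
    move=> /blockE bm; rewrite /c bm kS lognM ?expn_gt0// pfactorK//.
    rewrite [logn _ _.*2.+1]lognE /= dvdn2 /= odd_double /= addn0.
    by rewrite pickleK.
  have Ck : C <= k%:R.
    apply: le_trans (_ : (Num.truncn C).+1%:R <= _); first exact/ltW/truncnS_gt.
    rewrite ler_nat -ltnS kS.
    apply: leq_trans (leq_pmull _ _); last by rewrite expn_gt0.
    by rewrite -muln2; lia.
  exists (cut k.+1); apply: le_trans Ck (le_trans (dk k) _).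
  rewrite [leRHS](big_cat_nat (n := cut k))//=; last exact: ltnW.
  rewrite addrC -[leLHS]addr0 lerD//.
    rewrite le_eqVlt; apply/orP; left; apply/eqP.
    rewrite [RHS]big_mkcond; apply: eq_big_nat => m /ck ->.
    by rewrite eqxx.
  by apply: sumr_ge0 => m _; rewrite le_max lexx orbT.
by split; apply: heavy_class => k; have [] := nextP (k, cut k).
Qed.

(** Since |a| = 2 max(a, 0) - a, bounded positive mass and convergence would bound the absolute
    partial sums. *)
Lemma conditionally_convergent_heavy (R : realType) (a : R^nat) :
  conditionally_convergent a -> heavy a predT.
Proof.
move=> [acvg ancvg]; apply: contrapT => /existsNP[C aC]; apply: ancvg.
have {}aC N : \sum_(0 <= m < N) Num.max (a m) 0 <= C.
  by rewrite leNgt; apply/negP => /ltW CN; apply: aC; exists N.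
have /cvg_seq_bounded[M [_ aM]] := acvg.
apply: nondecreasing_is_cvgn; first by apply: nondecreasing_series => n _ _ /=.
exists (C *+ 2 + (M + 1)) => _ [N _ <-].
have -> : [normed series a] N = (\sum_(0 <= m < N) Num.max (a m) 0) *+ 2 - series a N.
  rewrite /series /= -sumrMnl -sumrB; apply: eq_bigr => m _.
  by case: (lerP 0 (a m)) => am; [rewrite ger0_norm|rewrite ltr0_norm]; lra.
apply: lerD; first by rewrite lerMn2r aC orbT.
apply: le_trans (aM (M + 1) _ N I); last by rewrite ltrDl.
by rewrite -normrN ler_norm.
Qed.

Lemma conditionally_convergentN (R : realType) (a : R^nat) :
  conditionally_convergent a -> conditionally_convergent (- a).
Proof.
move=> [acvg ancvg]; split; first by rewrite is_cvg_seriesN.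
suff -> : [normed series (- a)] = [normed series a] by [].
by congr series; apply/funext => m /=; rewrite normrN.
Qed.

(** * Prescribing the sums along countably many lines *)

(** Here [pt i k] is the point at position [k] of an abstract line [i]. The last hypothesis ensures
    that each line owns all but finitely many of its points. *)
Lemma prescribed_line_sums (R : realType) (X : Type) (I : countType) (i0 : I)
    (pt : I -> nat -> X) (a : R^nat) (t : I -> \bar R) :
  conditionally_convergent a ->
  (forall i, injective (pt i)) ->
  (forall x, exists i k, pt i k = x) ->
  (forall i j, i != j -> exists B, forall k l, pt i k = pt j l -> (k < B)%N) ->
  exists2 tau : X -> nat, bijective tau &
    forall i, (series (fun k => a (tau (pt i k))) n)%:E @[n --> \oo] --> t i.
Proof.
move=> acc pt_inj pt_surj pt_meet.
(* [own x] is the line of least code through [x], with the position of [x] on it. *)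
have /choice[own ownP] x : exists ik : I * nat, pt ik.1 ik.2 = x /\
    forall j l, pt j l = x -> (pickle ik.1 <= pickle j)%N.
  have : exists n, `[< exists i k, pt i k = x /\ pickle i = n >].
    have [i [k ikx]] := pt_surj x.
    by exists (pickle i); apply/asboolP; exists i, k.
  case/ex_minnP => n /asboolP[i [k [ikx <-]]] imin.
  exists (i, k); split=> // j l jlx; apply: imin.
  by apply/asboolP; exists j, l.
(* The prefilled positions of line [i]: their points belong to lines of smaller code. *)
pose U i k := (own (pt i k)).1 != i.
have U_lt i k : U i k -> (pickle (own (pt i k)).1 < pickle i)%N.
  have [_ /(_ i k erefl)] := ownP (pt i k).
  rewrite leq_eqVlt => /orP[/eqP|//].
  by move=> /(pcan_inj pickleK) /eqP; rewrite /U => ->.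
have /choice[B UB] i : exists B, forall k, (B <= k)%N -> ~~ U i k.
  have [B BP] : exists B, forall j, (pickle j < pickle i)%N ->
      forall k l, pt i k = pt j l -> (k < B)%N.
    have : (pickle i <= pickle i)%N by [].
    elim: {1 3}(pickle i) => [|N IH] Ni; first by exists 0%N.
    have [B BP] := IH (ltnW Ni).
    have [[j ji]|noj] := pselect (exists j : I, pickle j = N); last first.
      exists B => j; rewrite ltnS leq_eqVlt => /orP[/eqP jN|/BP//].
      by exfalso; apply: noj; exists j.
    have [|B' B'P] := pt_meet i j.
      by apply/eqP => ij; rewrite ij ji ltnn in Ni.
    exists (maxn B B') => j'; rewrite ltnS leq_eqVlt => /orP[/eqP j'N|/BP j'B] k l.
      have -> : j' = j by apply: (pcan_inj pickleK); rewrite ji.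
      by move=> /B'P; rewrite leq_max orbC => ->.
    by move=> /j'B; rewrite leq_max => ->.
  exists B => k Bk; apply/negP => /U_lt /BP.
  by move=> /(_ k (own (pt i k)).2); rewrite (ownP (pt i k)).1 ltnNge Bk => /(_ erefl).
have [c cP] := heavy_partition i0 (conditionally_convergent_heavy acc)
  (conditionally_convergent_heavy (conditionally_convergentN acc)).
have a0 : a @ \oo --> (0 : R) by apply: cvg_series_cvg_0; case: acc.
(* A filling is chosen for all possible prefilled values at once, since the actual ones emerge only
   during the recursion over lines. *)
have /choice[fill fillP] (iv : I * R^nat) : exists pi,
    fills (fun m => c m == iv.1) (U iv.1) pi /\
    (series (fun k => if U iv.1 k then iv.2 k else a (pi k)) n)%:E
      @[n --> \oo] --> t iv.1.
  case: iv => i v /=; have [ch cNh] := cP i.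
  by have [pi] := riemann_fill v (t i) a0 ch cNh (UB i); exists pi.
pose val (T : I -> nat -> nat) i k :=
  a (T (own (pt i k)).1 (own (pt i k)).2).
(* [stage n] holds the final filling of the lines with code below [n]. At positions in [U i] the
   owner has smaller code than [i], so the placeholder 0 is not met there. *)
pose stage := fix stage n := if n is n'.+1 then fun i =>
  if pickle i == n' then fill (i, val (stage n') i) else stage n' i
  else fun _ _ => 0%N.
pose pi i := stage (pickle i).+1 i.
have stageE n i : (pickle i < n)%N -> stage n i = pi i.
  elim: n => // n IH; rewrite ltnS leq_eqVlt => /orP[/eqP <-//|ni] /=.
  by rewrite ltn_eqF// IH.
have piE i : pi i = fill (i, val (stage (pickle i)) i) by rewrite /pi /= eqxx.
pose tau x := pi (own x).1 (own x).2.
have own_pt i k : ~~ U i k -> own (pt i k) = (i, k).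
  rewrite negbK => /eqP iE; have [] := ownP (pt i k).
  by rewrite iE => /pt_inj kE _; rewrite [LHS]surjective_pairing iE kE.
have ownU x : ~~ U (own x).1 (own x).2 by rewrite /U (ownP x).1 eqxx.
have pi_fills i : fills (fun m => c m == i) (U i) (pi i).
  by rewrite piE; case: (fillP (i, val (stage (pickle i)) i)).
exists tau.
  rewrite -setTT_bijective; split=> [//|x y _ _ xy|m _].
    (* The class of an index reveals the owner of its point, so points with different owners cannot
       collide. *)
    have cE z : c (tau z) = (own z).1.
      by have [_ /(_ _ (ownU z))/eqP] := pi_fills (own z).1.
    have owE : (own x).1 = (own y).1 by rewrite -!cE xy.
    rewrite -(ownP x).1 -(ownP y).1 owE; congr pt.
    have [pi_inj _ _] := pi_fills (own y).1; apply: pi_inj.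
    - by rewrite !inE -owE; exact: ownU.
    - exact: ownU.
    - by move: xy; rewrite /tau owE.
  have [_ _ /(_ m (eqxx _))[k Uk <-]] := pi_fills (c m).
  by exists (pt (c m) k) => //; rewrite /tau own_pt.
move=> i; have [_] := fillP (i, val (stage (pickle i)) i); rewrite -piE /=.
suff -> : (fun k => a (tau (pt i k))) = (fun k => if U i k
    then val (stage (pickle i)) i k else a (pi i k)) by [].
apply/funext => k; case: ifP => [Uk|/negbT Uk]; last by rewrite /tau own_pt.
by rewrite /val /tau stageE// U_lt.
Qed.

(** * Axis-parallel lines in N^n *)

(** As [k] varies, this runs along the line in direction [d] with remaining coordinates [u]. *)
Definition insert_coord (m : nat) (d : 'I_m.+1) (u : m.-tuple nat) (k : nat) :
    m.+1.-tuple nat :=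
  [tuple if unlift d i is Some j then tnth u j else k | i < m.+1].

Lemma tnth_insert_coord (m : nat) (d : 'I_m.+1) (u : m.-tuple nat) (k : nat) :
  tnth (insert_coord d u k) d = k.
Proof. by rewrite tnth_mktuple unlift_none. Qed.

Lemma tnth_insert_coord_lift (m : nat) (d : 'I_m.+1) (u : m.-tuple nat) (k : nat)
  (j : 'I_m) : tnth (insert_coord d u k) (lift d j) = tnth u j.
Proof. by rewrite tnth_mktuple liftK. Qed.

Lemma rearrangement_line_sums (R : realType) (m : nat) (a : R^nat)
    (t : 'I_m.+1 -> m.-tuple nat -> \bar R) :
  conditionally_convergent a ->
  exists b : m.+1.-tuple nat -> R, rearrangement a b /\ forall d u,
    (series (fun k => b (insert_coord d u k)) n)%:E @[n --> \oo] --> t d u.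
Proof.
move=> acc; pose pt (i : 'I_m.+1 * m.-tuple nat) := insert_coord i.1 i.2.
have [|||tau tau_bij cvg] := @prescribed_line_sums R _ _ (ord0, [tuple 0%N | _ < m])
  pt a (fun i => t i.1 i.2) acc.
- move=> [d u] k l /(congr1 (fun x => tnth x d)).
  by rewrite !tnth_insert_coord.
- move=> x; exists (ord0, [tuple tnth x (lift ord0 j) | j < m]), (tnth x ord0).
  apply: eq_from_tnth => i; rewrite tnth_mktuple.
  by case: unliftP => [j ->|-> //]; rewrite tnth_mktuple.
(* Distinct parallel lines are disjoint. If [d != d'], coordinate [d] is constant on the second line
   and equals the position [k] of a common point. *)
- move=> [d u] [d' u'] neq; exists (tnth (insert_coord d' u' 0%N) d).+1 => k l.
  rewrite /pt /= => ptE; have [dd|dd] := eqVneq d d'.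
    case/eqP: neq; rewrite -{}dd in ptE *; congr (_, _).
    apply: eq_from_tnth => j.
    by rewrite -(tnth_insert_coord_lift d u k) ptE tnth_insert_coord_lift.
  rewrite -(tnth_insert_coord d u k) ptE ltnS.
  have [j -> _] : exists2 j, d = lift d' j & True.
    by case: (unliftP d' d) dd => [j ->|->]; [exists j|rewrite eqxx].
  by rewrite !tnth_insert_coord_lift.
exists (fun j => a (tau j)); split; first by exists tau.
by move=> d u; exact: cvg (d, u).
Qed.

(** * Induction on the dimension *)

Lemma iterated_sum_rcons (R : realType) (m : nat) (f : m.+1.-tuple nat -> R)
    (g : m.-tuple nat -> R) (s : \bar R) :
  (forall u : m.-tuple nat, (series (fun k => f [tuple of rcons u k]) n)%:E
     @[n --> \oo] --> (g u)%:E) ->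
  iterated_sum g s -> iterated_sum f s.
Proof.
elim: m f g s => [|m IH] f g s fg.
  move=> /= ->; exists (fun k => f [tuple of rcons [tuple] k]); last exact: fg.
  by move=> k; congr (_%:E); congr f; apply: val_inj.
move=> [h gh hs]; exists h => // j; apply: IH (gh j) => u.
have -> : (fun k => f [tuple of j :: [tuple of rcons u k]]) =
    (fun k => f [tuple of rcons [tuple of j :: u] k]).
  by apply/funext => k; congr f; apply: val_inj.
exact: fg.
Qed.

(** The last index, over which the innermost sum runs, lands in coordinate [d], the preimage of
    [ord_max]. *)
Lemma permute_index_rcons (m : nat) (d : 'I_m.+1) (sigma : 'S_m)
    (u : m.-tuple nat) (k : nat) :
  permute_index (lift_perm d ord_max sigma) [tuple of rcons u k] =
  insert_coord d (permute_index sigma u) k.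
Proof.
apply: eq_from_tnth => i; rewrite !tnth_mktuple.
case: unliftP => [j|] ->.
  rewrite lift_perm_lift tnth_mktuple !(tnth_nth 0%N) lift_max nth_rcons size_tuple.
  by rewrite ltn_ord.
by rewrite lift_perm_id (tnth_nth 0%N) /= nth_rcons size_tuple ltnn eqxx.
Qed.

Lemma lift_perm_surj (m : nat) (i j : 'I_m.+1) (sigma : 'S_m.+1) :
  sigma i = j -> exists sigma', sigma = lift_perm i j sigma'.
Proof.
move=> sij; have neq k : j != sigma (lift i k).
  by rewrite -sij (inj_eq perm_inj) neq_lift.
pose f k := odflt k (unlift j (sigma (lift i k))).
have fE k : lift j (f k) = sigma (lift i k).
  by rewrite /f; have [l -> ->] := unlift_some (neq k).
have f_inj : injective f.
  by move=> k l /(congr1 (lift j)); rewrite !fE => /perm_inj/lift_inj.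
exists (perm f_inj); apply/permP => k; case: (unliftP i k) => [l|] ->.
  by rewrite lift_perm_lift permE fE.
by rewrite lift_perm_id.
Qed.

Unset Implicit Arguments.

Theorem corollary2 (R : realType) (n : nat) (hn : (1 <= n)%N) (a : R^nat)
    (ha : conditionally_convergent a) (s : 'S_n -> \bar R) :
  exists b : n.-tuple nat -> R,
    rearrangement a b /\
    forall sigma : 'S_n,
      iterated_sum (fun j => b (permute_index sigma j)) (s sigma).
Proof.
case: n hn s => [//|m] _; elim: m => [|m IH] s.
  have [b [ab bs]] := rearrangement_line_sums (m := 0) (fun _ _ => s 1%g) ha.
  exists b; split=> // sigma; exists (fun k => b [tuple k]) => [k|].
    by rewrite /=; congr (b _)%:E; apply: eq_from_tnth => i;
      rewrite tnth_mktuple !ord1.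
  have -> : sigma = 1%g by apply/permP => i; rewrite !ord1.
  have -> : (fun k => b [tuple k]) = (fun k => b (insert_coord ord0 [tuple] k)).
    apply/funext => k; congr b; apply: eq_from_tnth => i.
    by rewrite ord1 tnth_insert_coord.
  exact: bs.
have /choice[L LP] (d : 'I_m.+2) : exists L : m.+1.-tuple nat -> R,
    forall sigma : 'S_m.+1, iterated_sum (fun j => L (permute_index sigma j))
      (s (lift_perm d ord_max sigma)).
  by have [L [_ Ls]] := IH (fun sigma => s (lift_perm d ord_max sigma)); exists L.
have [b [ab bL]] := rearrangement_line_sums (m := m.+1) (fun d u => (L d u)%:E) ha.
exists b; split=> // sigma.
(* The innermost sum for [sigma] runs in direction [sigma^-1 ord_max]. *)
have [sigma' ->] := lift_perm_surj (permKV sigma ord_max).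
apply: iterated_sum_rcons (LP _ sigma') => u.
under [X in series X]eq_fun do rewrite permute_index_rcons.
exact: bL.
Qed.
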